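(* For every integer $n\ge 2$, one has $D(n)=3^k$, where $k=\min\{j\in\mathbb{Z}^{+}:\ 3^j\ge \sqrt{n}\}$.
   Context: $\mathbb{Z}^{+}$ is the set of positive integers. For an integer $n\ge 2$, $D(n)$ denotes the smallest positive integer $m$ such that the numbers $a^3+a$ $(1\le a\le n)$ are pairwise distinct modulo $m^2$. *)

(* Defs.v *)
From mathcomp Require Import all_boot all_order all_algebra.
From mathcomp Require Import reals.
Set Implicit Arguments.
Unset Strict Implicit.
Unset Printing Implicit Defensive.
Import Order.TTheory GRing.Theory Num.Theory.

Definition distinct_mod_sq (n m : nat) : bool :=
  pairwise (fun x y => x != y %[mod m ^ 2]) [seq a ^ 3 + a | a <- iota 1 n].

Lemma D_exists (n : nat) : exists m, (0 < m) && distinct_mod_sq n m.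
Proof.
exists (n ^ 3 + n).+1; rewrite /= /distinct_mod_sq pairwise_map.
have small x : x \in iota 1 n -> x ^ 3 + x < (n ^ 3 + n).+1 ^ 2.
  rewrite mem_iota add1n ltnS => /andP[_ le_xn].
  apply: (@leq_trans (n ^ 3 + n).+1); last by rewrite leq_pmulr.
  by rewrite ltnS leq_add // leq_exp2r.
have: pairwise ltn (iota 1 n).
  by rewrite -(sorted_pairwise ltn_trans) iota_ltn_sorted.
apply: (@sub_in_pairwise _ (mem (iota 1 n))); last by apply/allP.
move=> x y /small lt_x /small lt_y /= lt_xy.
by rewrite !modn_small // neq_ltn -addSn leq_add ?(ltnW lt_xy) // ltn_exp2r.
Qed.

Definition D (n : nat) : nat := ex_minn (D_exists n).

Lemma min_exponent_exists (R : realType) (n : nat) :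
  exists j, (0 < j) && (Num.sqrt n%:R <= 3 ^+ j :> R)%R.
Proof.
exists n.+1; rewrite /=.
have le_n : n <= (3 ^ n.+1) ^ 2.
  apply: (@leq_trans (3 ^ n.+1)); last by rewrite leq_pmulr // expn_gt0.
  by apply: ltnW; apply: ltn_trans (ltnSn n) (ltn_expl _ _).
rewrite -[leRHS]ger0_norm ?exprn_ge0 // -sqrtr_sqr ler_wsqrtr //.
by rewrite -!natrX ler_nat.
Qed.

Definition min_exponent (R : realType) (n : nat) : nat :=
  ex_minn (min_exponent_exists R n).

(* Main.v *)
(** Since [b^3 + b - (a^3 + a) = (b - a) (a^2 + a b + b^2 + 1)] and the second
    factor is [(b - a)^2 + 1] modulo 3, the values are distinct modulo [9^k]
    whenever [n <= 9^k].  Conversely every [m] admits a collision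
    [m^2 | h (3 a^2 + 3 a h + h^2 + 1)], with [b = a + h], among the first
    [9^K + 1] integers, where [3^K <= m < 3^(K+1)]; as [9^K > m^2 / 9], it is
    essentially enough to get [b <= m^2 / 9].

    One writes [m^2 = d e], takes [h] to be a multiple of [d] and solves the
    quadratic congruence in [a] modulo [e].  If a prime [p = 1 (mod 3)] divides
    [m] one can take [e = p] (or [49] for [p = 7]), if [4 | m] a power of 2, and
    [a = 1], [h = 9^j] do for [m = 3^j] and [m = 2 3^j].  Otherwise [m = p^s t]
    with [p = 2 (mod 3)] odd; [e = p^(2s)] and [d = t^2] work when [t >= 5].
    When [t <= 3] one puts [a = t^2 x] and [b = t^2 y] and needs [t^4 (x^2 + x
    y + y^2) + 1 = 0] modulo [Q^2], where [Q = p^s] and [x, y <= Q^2 / 9]. The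
    solutions above a fixed solution modulo [Q] form a line [u i + v j = c]
    modulo [Q] in the coordinates [x = x0 + Q i], [y = y0 + Q j], and its
    direction [(u, v)] can be any pair whose norm [u^2 - u v + v^2] is a
    nonsquare modulo [p]. Thue's lemma gives such a pair of size at most [sqrt
    p], for which the line meets the box [0 <= i, j < Q / 9] as soon as [v] is
    not too small; a small pair is first multiplied by the square of an
    Eisenstein integer of norm 7. This covers [Q >= 900]; smaller [Q] use
    explicit directions or explicit collisions. *)
Require Import Defs.
From Stdlib Require Import BinNat.
From Stdlib Require PeanoNat.
From mathcomp Require Import all_boot all_order all_algebra.
From mathcomp Require Import all_fingroup all_solvable all_field.
From mathcomp Require Import reals.
From mathcomp Require Import ring lra zify.
Set Implicit Arguments.
Unset Strict Implicit.
Unset Printing Implicit Defensive.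
Import Order.TTheory GRing.Theory Num.Theory.

Local Open Scope ring_scope.

(** * Squares modulo a prime *)

Definition is_square (F : finFieldType) (x : F) := [exists y, y ^+ 2 == x].

Lemma is_squareM (F : finFieldType) (x y : F) :
  is_square x -> is_square y -> is_square (x * y).
Proof.
move=> /existsP[a /eqP<-] /existsP[b /eqP<-].
by apply/existsP; exists (a * b); rewrite exprMn.
Qed.

Lemma is_square_exp2 (F : finFieldType) (x : F) : is_square (x ^+ 2).
Proof. by apply/existsP; exists x. Qed.

Lemma is_square0 (F : finFieldType) : is_square (0 : F).
Proof. by apply/existsP; exists 0; rewrite expr0n. Qed.

(** The unit group is cyclic, and a nonsquare is an odd power of a generator. *)
Lemma nonsquareM (F : finFieldType) (x y : F) :
  ~~ is_square x -> ~~ is_square y -> is_square (x * y).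
Proof.
have [g gen_g] := cyclicP (field_unit_group_cyclic [group of [set: {unit F}]]).
have pow_g (z : F) : ~~ is_square z ->
    exists2 i, odd i & z = FinRing.uval g ^+ i.
  move=> nsq_z; have z_neq0 : z != 0.
    by apply: contraNneq nsq_z => ->; rewrite is_square0.
  have Uz : z \is a GRing.unit by rewrite unitfE.
  have /cycleP[i def_z] : FinRing.unit F Uz \in <[g]>%g by rewrite -gen_g inE.
  have {}def_z : z = FinRing.uval g ^+ i.
    by rewrite -FinRing.val_unitX -def_z.
  exists i => //; apply: contraNT nsq_z => /even_halfK i_even.
  by rewrite def_z -i_even -muln2 exprM is_square_exp2.
move=> /pow_g[i odd_i ->] /pow_g[j odd_j ->].
rewrite -exprD -(@even_halfK (i + j)) ?oddD ?odd_i ?odd_j //.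
by rewrite -muln2 exprM is_square_exp2.
Qed.

(* Otherwise the set of squares would be stable under adding [c]. *)
Lemma exists_nonsquare_shift (p : nat) (c z : 'F_p) :
  c != 0 -> ~~ is_square z -> exists x, ~~ is_square (x ^+ 2 + c).
Proof.
move=> c_neq0 nsq_z; apply/existsP; rewrite -[[exists _, _]]negbK negb_exists.
apply: contra nsq_z => /forallP sq.
have sq_mul n : is_square (c *+ n).
  elim: n => [|n /existsP[x /eqP def_x]].
    by rewrite mulr0n is_square0.
  by rewrite mulrSr -def_x -[is_square _]negbK sq.
have := sq_mul (z / c : 'F_p); rewrite -mulr_natr natr_Zp.
by rewrite mulrC divfK.
Qed.

Lemma natF_neq0 (p n : nat) : prime p -> (n%:R != 0 :> 'F_p) = ~~ (p %| n)%N.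
Proof. by move=> p_pr; rewrite (dvdn_pcharf (pchar_Fp p_pr)). Qed.

Lemma natF_2_3_neq0 (p : nat) : prime p -> (p %% 3 = 2)%N -> (2 < p)%N ->
  2%:R != 0 :> 'F_p /\ 3%:R != 0 :> 'F_p.
Proof.
move=> p_pr p_mod p_gt2.
rewrite !natF_neq0 // !dvdn_prime2 //; split; lia.
Qed.

(** From a square root [y] of -3, [w = (y - 1) / 2] satisfies [w^3 = 1]. As [w^p = w] and p = 2 mod
    3, also [w^2 = w], which forces [w = 1] and then 3 = 0. *)
Lemma nonsquareN3 (p : nat) :
  prime p -> (p %% 3 = 2)%N -> (2 < p)%N -> ~~ is_square (- 3%:R : 'F_p).
Proof.
move=> p_pr p_mod p_gt2; apply/negP => /existsP[y /eqP y2].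
have [two_neq0 three_neq0] := natF_2_3_neq0 p_pr p_mod p_gt2.
pose w : 'F_p := (y - 1) / 2%:R.
have w_poly : w ^+ 2 + w + 1 = 0.
  have -> : w ^+ 2 + w + 1 = (y ^+ 2 + 3%:R) / (2%:R * 2%:R).
    by rewrite /w; field; rewrite (natrM _ 2 2) mulf_neq0 ?two_neq0.
  by rewrite y2 addNr mul0r.
have w3 : w ^+ 3 = 1.
  have -> : w ^+ 3 = (w - 1) * (w ^+ 2 + w + 1) + 1 by ring.
  by rewrite w_poly mulr0 add0r.
have w_p : w ^+ p = w by rewrite -[X in w ^+ X](card_Fp p_pr) expf_card.
have w2 : w ^+ 2 = w.
  rewrite -[RHS]w_p [in RHS](_ : w ^+ p = w ^+ (p %/ 3 * 3 + p %% 3)).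
    by rewrite p_mod exprD mulnC exprM w3 expr1n mul1r.
  by rewrite -divn_eq.
have w1 : w = 1 by rewrite -w3 exprSr w2 -expr2 w2.
move/eqP: w_poly; rewrite w1 expr1n (_ : 1 + 1 + 1 = 3%:R); last by ring.
by rewrite (negPf three_neq0).
Qed.

(** Cauchy's theorem gives [w] of order 3; then [(2 w + 1)^2 = -3], and the inverse of [2 w + 1] is
    the root. *)
Lemma exists_root_3x2_plus1 (p : nat) :
  prime p -> (p %% 3 = 1)%N -> exists x : 'F_p, 3%:R * x ^+ 2 + 1 = 0.
Proof.
move=> p_pr p_mod.
have three_dvd : (3 %| #|[set: {unit 'F_p}]%G|)%N.
  by rewrite card_finField_unit card_Fp //; have := prime_gt0 p_pr; lia.
have [u _ ord_u] := Cauchy (isT : prime 3) three_dvd.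
pose w := FinRing.uval u.
have w3 : w ^+ 3 = 1 by rewrite -FinRing.val_unitX -ord_u expg_order.
have w_neq1 : w - 1 != 0.
  rewrite subr_eq0; apply/negP => /eqP w1.
  have u1 : u = 1%g by apply: val_inj.
  by move: ord_u; rewrite u1 order1.
have w_poly : w ^+ 2 + w + 1 = 0.
  by apply: (mulfI w_neq1); rewrite mulr0 -(subrr (1 : 'F_p)) -{3}w3; ring.
have three_neq0 : 3%:R != 0 :> 'F_p.
  rewrite natF_neq0 // dvdn_prime2 //; lia.
have sq : (2%:R * w + 1) ^+ 2 = - 3%:R.
  have -> : (2%:R * w + 1) ^+ 2 = 4%:R * (w ^+ 2 + w + 1) - 3%:R by ring.
  by rewrite w_poly mulr0 add0r.
have nz : 2%:R * w + 1 != 0.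
  by rewrite -sqrf_eq0 sq oppr_eq0.
exists (2%:R * w + 1)^-1.
by rewrite exprVn sq invrN mulrN divff // addNr.
Qed.

(** * Roots of quadratic polynomials modulo prime powers *)

(* The discriminant hypothesis makes every root modulo [p] simple, because
   [(2 A x + B)^2] is the discriminant plus [4 A (A x^2 + B x + C)]. *)
Lemma quadratic_hensel (p : nat) (A B C x0 : int) (r : nat) :
    (0 < p)%N -> coprimez p (B ^+ 2 - 4 * A * C) ->
    (p %| A * x0 ^+ 2 + B * x0 + C)%Z ->
  exists2 a : nat, (a < p ^ r)%N
    & ((p ^ r)%N %| A * a%:Z ^+ 2 + B * a%:Z + C)%Z.
Proof.
move=> p_gt0 /coprimezP[[u w] /= bez] root_x0.
have [x /dvdzP[q def_Fx]] :
    exists x : int, ((p ^ r)%N %| A * x ^+ 2 + B * x + C)%Z.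
  case: r => [|r]; first by exists 0; rewrite dvd1z.
  elim: r => [|r [x /dvdzP[q def_Fx]]]; first by exists x0; rewrite expn1.
  pose D := 2 * A * x + B.
  (* Newton step: modulo [p] the discriminant is [D^2] and has inverse [w], so [w * D] inverts the
     derivative [D]. *)
  pose t := - (q * w * D).
  exists (x + (p ^ r.+1)%N%:Z * t); apply/dvdzP.
  exists (q * (u - 4 * w * A * q * (p ^ r)%N%:Z) + A * (p ^ r)%N%:Z * t ^+ 2).
  have -> : A * (x + (p ^ r.+1)%N%:Z * t) ^+ 2
      + B * (x + (p ^ r.+1)%N%:Z * t) + C
     = A * x ^+ 2 + B * x + C + (p ^ r.+1)%N%:Z * (t * D)
      + A * (p ^ r.+1)%N%:Z ^+ 2 * t ^+ 2 by rewrite /D; ring.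
  have D2 : D ^+ 2 = B ^+ 2 - 4 * A * C + 4 * A * (A * x ^+ 2 + B * x + C).
    by rewrite /D; ring.
  have qtD : q + t * D
      = q * (u - 4 * w * A * q * (p ^ r)%N%:Z) * p%:Z.
    have -> : q + t * D
        = q * (u * p + w * (B ^+ 2 - 4 * A * C)) - q * w * D ^+ 2.
      by rewrite bez /t; ring.
    by rewrite D2 def_Fx expnSr PoszM; ring.
  rewrite def_Fx [q * _]mulrC -mulrDr qtD.
  by rewrite [(p ^ r.+2)%N]expnSr [(p ^ r.+1)%N]expnSr !PoszM; ring.
have P_gt0 : (0 < p ^ r)%N by rewrite expn_gt0 p_gt0.
have P_neq0 : (p ^ r)%N%:Z != 0 by rewrite -lt0n.
have modE : `|(x %% (p ^ r)%N)%Z|%N%:Z = (x %% (p ^ r)%N)%Z.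
  by rewrite gez0_abs // modz_ge0.
exists `|(x %% (p ^ r)%N)%Z|%N; first by rewrite -ltz_nat modE ltz_pmod.
rewrite modE; apply/dvdzP.
set P := (p ^ r)%N%:Z in def_Fx *; pose k := (x %/ P)%Z.
have -> : (x %% P)%Z = x - k * P by rewrite {2}(divz_eq x P) addrC addKr.
exists (q + A * (k ^+ 2 * P - 2 * k * x) - B * k).
have -> : (q + A * (k ^+ 2 * P - 2 * k * x) - B * k) * P
  = q * P + A * ((k * P) ^+ 2 - 2 * (k * P) * x) - B * (k * P) by ring.
by rewrite -def_Fx; ring.
Qed.

Lemma quadratic_hensel_nat (p A B C : nat) (x0 : int) (r : nat) :
    (0 < p)%N -> coprimez p (B%:Z ^+ 2 - 4 * A%:Z * C%:Z) ->
    (p %| A%:Z * x0 ^+ 2 + B%:Z * x0 + C%:Z)%Z ->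
  exists2 a : nat, (a < p ^ r)%N & (p ^ r %| A * a ^ 2 + B * a + C)%N.
Proof.
move=> p_gt0 co_disc root_x0.
have [a a_lt] := quadratic_hensel r p_gt0 co_disc root_x0.
have -> : A%:Z * a%:Z ^+ 2 + B%:Z * a%:Z + C%:Z = (A * a ^ 2 + B * a + C)%N%:Z.
  by rewrite -mulnn !PoszD !PoszM; ring.
by exists a.
Qed.

(** * Small solutions of [x^2 + x y + y^2 = - 1 / t^2] modulo [p^(2s)] *)

Definition norm_form (u v : int) : int := u ^+ 2 - u * v + v ^+ 2.

(* With [9 (Q %/ 9) >= Q - 8], the last condition implies
   [|u| (v - 1) + Q - 1 <= v (Q %/ 9 - 1)], so that any [n] in a suitable range
   of length [Q] is [u s + v t] with [0 <= s < v] and [0 <= t < Q %/ 9]. *)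
Definition wide_direction (Q : nat) (u v : int) : bool :=
  [&& 0 < v, 9 * v + 8 <= Q%:Z
    & 9 * `|u| * (v - 1) + 17 * v <= (v - 9) * Q%:Z + 9].

Lemma line_meets_box (Q : nat) (u v c : int) :
    coprimez u v -> wide_direction Q u v ->
  exists s t : nat, [/\ (s < Q %/ 9)%N, (t < Q %/ 9)%N
    & (Q %| u * s%:Z + v * t%:Z - c)%Z].
Proof.
move=> /coprimezP[[a b] /= bez] /and3P[v_gt0 v_le crit].
pose S := (Q %/ 9)%N.
have S_bound : 9 * S%:Z + 8 >= Q%:Z by rewrite /S; lia.
(* [l] is the maximum of [u * s] over 0 <= s < v, so n >= l forces t >= 0. *)
pose l := Num.max 0 (u * (v - 1)).
have [n [n_ge n_le /dvdzP[k def_n]]] :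
    exists n, [/\ l <= n, n <= l + Q%:Z - 1 & (Q %| n - c)%Z].
  have Q_neq0 : Q%:Z != 0 by lia.
  exists (l + ((c - l) %% Q)%Z); split.
  - by rewrite lerDl modz_ge0.
  - have := @ltz_pmod (c - l) Q; lia.
  have := divz_eq (c - l) Q; move: (_ %/ _)%Z => k eq_k.
  by apply/dvdzP; exists (- k); lia.
have v_neq0 : v != 0 by lia.
pose s := (a * n %% v)%Z.
have s_ge0 : 0 <= s by rewrite modz_ge0.
have s_lt : s < v by rewrite ltz_pmod.
have [t def_t] : exists t, n = u * s + v * t.
  exists (b * n + u * (a * n %/ v)%Z); move: (divz_eq (a * n) v); rewrite -/s.
  move: (_ %/ _)%Z => k' eq_k.
  rewrite -[LHS]mul1r -bez.
  have -> : (a * u + b * v) * n = u * (a * n) + b * v * n by ring.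
  by rewrite eq_k; ring.
have box : `|u| * (v - 1) + Q%:Z - 1 <= v * (S%:Z - 1).
  have : 0 <= v * (9 * S%:Z + 8 - Q%:Z) by apply: mulr_ge0; lia.
  lia.
have [us_le us_ge] : u * s <= l /\ l - u * s <= `|u| * (v - 1).
  have [u_ge0|u_lt0] := leP 0 u.
    have ls : 0 <= u * (v - 1 - s) by apply: mulr_ge0; lia.
    have us : 0 <= u * s by apply: mulr_ge0.
    have uv : 0 <= u * (v - 1) by apply: mulr_ge0; lia.
    rewrite /l ger0_norm //; lia.
  have ls : 0 <= - u * (v - 1 - s) by apply: mulr_ge0; lia.
  have us : 0 <= - u * s by apply: mulr_ge0; lia.
  have uv : 0 <= - u * (v - 1) by apply: mulr_ge0; lia.
  rewrite /l ltr0_norm //; lia.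
have t_ge0 : 0 <= t by rewrite -(pmulr_rge0 _ v_gt0); lia.
have t_lt : t < S%:Z.
  have : v * t <= v * (S%:Z - 1) by lia.
  by rewrite ler_pM2l //; lia.
exists `|s|%N, `|t|%N; split; try (rewrite -/S; lia).
by apply/dvdzP; exists k; rewrite !gez0_abs // -def_t.
Qed.

Lemma dvdz_intF (p : nat) (z : int) :
  prime p -> (p %| z)%Z = (z%:~R == 0 :> 'F_p).
Proof. by move=> p_pr; rewrite (dvdz_pcharf (pchar_Fp p_pr)). Qed.

Lemma coprimez_intF (p : nat) (z : int) :
  prime p -> coprimez p z = (z%:~R != 0 :> 'F_p).
Proof. by move=> p_pr; rewrite -dvdz_intF // /coprimez -prime_coprime. Qed.

Lemma exists_int_lift (p : nat) (x : 'F_p) : exists z : int, z%:~R = x.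
Proof. by exists (x : nat)%:Z; rewrite -[RHS]natr_Zp. Qed.

(** Representatives are taken in 1..Q rather than 0..Q-1 because collisions are between positive
    integers. *)
Lemma exists_rep_pos (Q : nat) (z : int) :
  (0 < Q)%N -> exists x : nat, [/\ (0 < x)%N, (x <= Q)%N & (Q %| x%:Z - z)%Z].
Proof.
move=> Q_gt0; have Q_neq0 : Q%:Z != 0 by lia.
have := divz_eq (z - 1) Q; have := @modz_ge0 (z - 1) Q Q_neq0.
have := @ltz_pmod (z - 1) Q; move: (_ %/ _)%Z (_ %% _)%Z => k l l_lt l_ge0 eq_z.
exists `|(l + 1)%R|%N; split; try lia.
by apply/dvdzP; exists (- k); lia.
Qed.

Lemma box_bound (Q a b : nat) :
  (a <= Q)%N -> (b < Q %/ 9)%N -> (9 * (a + Q * b) <= Q ^ 2)%N.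
Proof.
move=> a_le b_lt.
have : (Q * (9 * b.+1) <= Q * Q)%N by rewrite leq_mul2l; lia.
lia.
Qed.

Definition nonsquare_direction (p : nat) (u v : int) : bool :=
  ~~ is_square ((norm_form u v)%:~R : 'F_p).

(* Above [(x0, y0) = (r (2 u - v), r (2 v - u))], where the gradient
   [(2 x0 + y0, x0 + 2 y0)] is [3 r (u, v)] and the form takes the value
   [3 r^2 norm_form u v], the lifting condition is an equation
   [u s + v t = c] modulo [Q]. *)
Lemma exists_small_solution (p s t : nat) (u v : int) :
    prime p -> (p %% 3 = 2)%N -> (2 < p)%N -> ~~ (p %| t)%N ->
    coprimez u v -> nonsquare_direction p u v ->
    wide_direction (p ^ s.+1) u v ->
  let Q := (p ^ s.+1)%N in
  exists x y : nat, [/\ (0 < x < y)%N, (9 * y <= Q ^ 2)%N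
    & (Q ^ 2 %| t ^ 2 * (x ^ 2 + x * y + y ^ 2) + 1)%N].
Proof.
move=> p_pr p_mod p_gt2 p_t co_uv nsq wide Q.
have [two_neq0 three_neq0] := natF_2_3_neq0 p_pr p_mod p_gt2.
have t_neq0 : t%:R != 0 :> 'F_p by rewrite natF_neq0.
set N := norm_form u v; set NF : 'F_p := N%:~R.
have N_neq0 : NF != 0.
  apply: contraNneq nsq => eq0.
  by rewrite /nonsquare_direction -/N -/NF eq0 is_square0.
have /existsP[y /eqP y2] : is_square (- 3%:R * NF).
  by apply: nonsquareM; first exact: nonsquareN3.
have [r0 def_r0] := exists_int_lift (y / (3%:R * NF * t%:R)).
have co_disc : coprimez p (0 ^+ 2 - 4 * (3 * N * t%:Z ^+ 2) * 1).
  rewrite coprimez_intF //.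
  have -> : (0 ^+ 2 - 4 * (3 * N * t%:Z ^+ 2) * 1)%:~R
      = - (2%:R * 2%:R * 3%:R * NF * t%:R ^+ 2) :> 'F_p by rewrite /NF; ring.
  by rewrite oppr_eq0 !mulf_neq0 // expf_neq0.
have root_r0 : (p %| 3 * N * t%:Z ^+ 2 * r0 ^+ 2 + 0 * r0 + 1)%Z.
  rewrite dvdz_intF //.
  have -> : (3 * N * t%:Z ^+ 2 * r0 ^+ 2 + 0 * r0 + 1)%:~R
    = 3%:R * NF * t%:R ^+ 2 * r0%:~R ^+ 2 + 1 :> 'F_p by rewrite /NF; ring.
  rewrite def_r0.
  have -> : 3%:R * NF * t%:R ^+ 2 * (y / (3%:R * NF * t%:R)) ^+ 2 + 1
     = y ^+ 2 / (3%:R * NF) + 1 by field; rewrite N_neq0 t_neq0 three_neq0.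
  by apply/eqP; rewrite y2; field; rewrite N_neq0 three_neq0.
have [r _ /dvdzP[w]] := quadratic_hensel s.+1 (prime_gt0 p_pr) co_disc root_r0.
rewrite -/Q mul0r addr0 => def_w.
have Q_gt0 : (0 < Q)%N by rewrite expn_gt0 prime_gt0.
have [x0 [x0_gt0 x0_le /dvdzP[al def_x0]]] :=
  exists_rep_pos (r%:Z * (2 * u - v)) Q_gt0.
have [y0 [y0_gt0 y0_le /dvdzP[be def_y0]]] :=
  exists_rep_pos (r%:Z * (2 * v - u)) Q_gt0.
have [e def_e] : exists e : int,
    t%:Z ^+ 2 * (x0%:Z ^+ 2 + x0%:Z * y0%:Z + y0%:Z ^+ 2) + 1 = e * Q%:Z.
  exists (w + t%:Z ^+ 2 * (3 * r%:Z * (u * al + v * be)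
     + Q%:Z * (al ^+ 2 + al * be + be ^+ 2))).
  rewrite [RHS]mulrDl -def_w /N /norm_form.
  have -> : x0%:Z = r%:Z * (2 * u - v) + al * Q%:Z by rewrite -def_x0; ring.
  have -> : y0%:Z = r%:Z * (2 * v - u) + be * Q%:Z by rewrite -def_y0; ring.
  ring.
(* Lifting requires [3 r t^2 (u s1 + v t1) + e = 0] modulo [Q]; since [3 N t^2 r^2 = -1] there,
   [u s1 + v t1 = N r e] suffices. *)
have [s1 [t1 [s1_lt t1_lt /dvdzP[k def_k]]]] :=
  line_meets_box (N * r%:Z * e) co_uv wide.
pose x := (x0 + Q * s1)%N; pose z := (y0 + Q * t1)%N.
have x_gt0 : (0 < x)%N by rewrite addn_gt0 x0_gt0.
have z_gt0 : (0 < z)%N by rewrite addn_gt0 y0_gt0.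
have sol : (Q ^ 2 %| t ^ 2 * (x ^ 2 + x * z + z ^ 2) + 1)%N.
  suff : ((Q ^ 2)%N%:Z %|
      t%:Z ^+ 2 * (x%:Z ^+ 2 + x%:Z * z%:Z + z%:Z ^+ 2) + 1)%Z.
    by rewrite /dvdz; congr (_ %| _)%N; lia.
  apply/dvdzP.
  exists (e * w + 3 * r%:Z * t%:Z ^+ 2 * k
     + t%:Z ^+ 2 * (s1%:Z * (2 * al + be) + t1%:Z * (al + 2 * be))
     + t%:Z ^+ 2 * (s1%:Z ^+ 2 + s1%:Z * t1%:Z + t1%:Z ^+ 2)).
  have -> : x%:Z = x0%:Z + Q%:Z * s1%:Z by rewrite /x PoszD PoszM.
  have -> : z%:Z = y0%:Z + Q%:Z * t1%:Z by rewrite /z PoszD PoszM.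
  have -> : t%:Z ^+ 2 * ((x0%:Z + Q%:Z * s1%:Z) ^+ 2
        + (x0%:Z + Q%:Z * s1%:Z) * (y0%:Z + Q%:Z * t1%:Z)
        + (y0%:Z + Q%:Z * t1%:Z) ^+ 2) + 1
     = (t%:Z ^+ 2 * (x0%:Z ^+ 2 + x0%:Z * y0%:Z + y0%:Z ^+ 2) + 1)
     + t%:Z ^+ 2 * Q%:Z
       * (s1%:Z * (2 * x0%:Z + y0%:Z) + t1%:Z * (x0%:Z + 2 * y0%:Z))
     + t%:Z ^+ 2 * Q%:Z ^+ 2 * (s1%:Z ^+ 2 + s1%:Z * t1%:Z + t1%:Z ^+ 2).
    by ring.
  rewrite def_e.
  have -> : x0%:Z = r%:Z * (2 * u - v) + al * Q%:Z by rewrite -def_x0; ring.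
  have -> : y0%:Z = r%:Z * (2 * v - u) + be * Q%:Z by rewrite -def_y0; ring.
  have -> : e * Q%:Z = e * (w * Q%:Z - 3 * N * t%:Z ^+ 2 * r%:Z ^+ 2) * Q%:Z.
    by rewrite -def_w; ring.
  have -> : s1%:Z * (2 * (r%:Z * (2 * u - v) + al * Q%:Z)
       + (r%:Z * (2 * v - u) + be * Q%:Z))
     + t1%:Z * (r%:Z * (2 * u - v) + al * Q%:Z
       + 2 * (r%:Z * (2 * v - u) + be * Q%:Z))
     = 3 * r%:Z * (u * s1%:Z + v * t1%:Z - N * r%:Z * e) + 3 * r%:Z ^+ 2 * N * e
       + (s1%:Z * (2 * al + be) + t1%:Z * (al + 2 * be)) * Q%:Z by ring.
  by rewrite def_k -mulnn PoszM; ring.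
(* If x = z, then [3 t^2 x^2 = -1] modulo [p], so [3 t x] is a square root of -3. *)
have x_neq_z : x != z.
  apply/eqP => xz; have /negP[] := nonsquareN3 p_pr p_mod p_gt2.
  apply/existsP; exists (3%:R * t%:R * x%:R); apply/eqP.
  have : (p %| t ^ 2 * (x ^ 2 + x * z + z ^ 2) + 1)%N.
    by apply: dvdn_trans sol; rewrite /Q -expnM; apply: dvdn_exp.
  rewrite (dvdn_pcharf (pchar_Fp p_pr)) -xz !(natrD, natrM, natrX) => /eqP eq0.
  rewrite -[RHS]addr0 -[X in _ = _ + X](mulr0 3%:R) -eq0; ring.
have x_le : (9 * x <= Q ^ 2)%N by apply: box_bound.
have z_le : (9 * z <= Q ^ 2)%N by apply: box_bound.
case: (ltngtP x z) x_neq_z => // [xz|zx] _;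
  [exists x, z | exists z, x]; split=> //.
- by rewrite x_gt0.
- by rewrite z_gt0.
- by rewrite [(_ + x ^ 2)%N]addnC [(z ^ 2 + _)%N]addnC addnA [(z * x)%N]mulnC.
Qed.

(** * Directions of nonsquare norm *)

(* Thue's lemma. *)
Lemma exists_small_ratio (p : nat) (l : 'F_p) : prime p ->
  exists u v : int, [/\ 0 < v, u ^+ 2 <= p%:Z, v ^+ 2 <= p%:Z
    & u%:~R = l * v%:~R].
Proof.
move=> p_pr; pose K := PeanoNat.Nat.sqrt p.
have [K_le K_lt] : (K * K <= p)%N /\ (p < K.+1 * K.+1)%N.
  by have := PeanoNat.Nat.sqrt_spec p; rewrite -/K; lia.
pose f (ij : 'I_K.+1 * 'I_K.+1) := l * (ij.1)%:R - (ij.2)%:R.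
have /injectivePn[[i j] [[i' j'] neq eq_f]] : ~~ injectiveb f.
  apply/injectiveP => /leq_card; rewrite card_Fp // card_prod !card_ord.
  by rewrite leqNgt K_lt.
have eq_int : (j%:Z - j'%:Z)%:~R = l * (i%:Z - i'%:Z)%:~R :> 'F_p.
  move/eqP: eq_f; rewrite /f /= -subr_eq0 => /eqP eq_f.
  apply/eqP; rewrite -subr_eq0 -oppr_eq0 -eq_f.
  by apply/eqP; rewrite !rmorphB /=; ring.
have neq_i : i%:Z - i'%:Z != 0.
  apply: contra neq; rewrite subr_eq0 => /eqP [eq_i].
  have : (p %| j%:Z - j'%:Z)%Z by rewrite dvdz_intF // eq_int eq_i subrr mulr0.
  rewrite (val_inj eq_i) => dvd_j.
  have p_gt1 := prime_gt1 p_pr.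
  rewrite xpair_eqE eqxx /=; apply/eqP/val_inj => /=.
  have := ltn_ord j; have := ltn_ord j'.
  move: dvd_j => /dvdzP[k eq_k] lt_j lt_j'.
  have [k_gt0|k_lt0|k0] := ltgtP k 0; [nia | nia |].
  by move: eq_k; rewrite k0 mul0r; lia.
have := ltn_ord i; have := ltn_ord i'; have := ltn_ord j; have := ltn_ord j'.
move=> j'_lt j_lt i'_lt i_lt.
have [i_i'|i'_i] := ltP (i%:Z - i'%:Z) 0.
  exists (- (j%:Z - j'%:Z)), (- (i%:Z - i'%:Z)); split; [lia|nia|nia|].
  by rewrite !rmorphN /= eq_int; ring.
exists (j%:Z - j'%:Z), (i%:Z - i'%:Z); split=> //; [lia|nia|nia].
Qed.

Lemma nonsquare_mul_exp2 (F : finFieldType) (a x : F) :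
  a != 0 -> is_square (a ^+ 2 * x) -> is_square x.
Proof.
move=> a_neq0 sq; rewrite -[x](mulKf (expf_neq0 2 a_neq0)) -exprVn.
exact/is_squareM/sq/is_square_exp2.
Qed.

(* [(u, v)] stands for [u + v w] with [w^2 = - 1 - w]: these are its multiples
   by the sixth roots of unity, the larger coordinate being put last. *)
Definition rotations (u v : int) : seq (int * int) :=
  [seq if `|w.1| <= `|w.2| then w else (w.2, w.1) | w <-
   [:: (u, v); (- v, u - v); (v - u, - u); (- u, - v); (v, v - u); (u - v, u)]].

(* Multiples of [u + v w] by [8 + 5 w = (3 + w)^2], or by its mirror image,
   which have norm 49.  The last condition is [wide_direction 900] divided by 9. *)
Definition rescalable (u v : int) : bool :=
  has (fun w => [&& norm_form w.1 w.2 == 49 * norm_form u v,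
      coprimez w.1 w.2, 0 < w.2 <= 99
    & `|w.1| * (w.2 - 1) + 2 * w.2 <= 100 * (w.2 - 9)])
  (rotations (8 * u - 5 * v) (5 * u + 3 * v)
    ++ rotations (3 * u + 5 * v) (8 * v - 5 * u)).

(** A direction with [v <= 9] is never wide, because of the factor [v - 9]; these finitely many
    directions are replaced by multiples of larger size. *)
Lemma small_rescalable (u v : int) :
    - 9 <= u <= 9 -> 0 < v <= 9 -> coprimez u v -> norm_form u v != 1 ->
  rescalable u v.
Proof.
pose ok u v := [|| ~~ coprimez u v, norm_form u v == 1 | rescalable u v].
have check : all (fun i : nat => all (fun j : nat => ok (i%:Z - 9) j%:Z)
    (iota 1 9)) (iota 0 19) by vm_compute.
move=> u_b v_b co_uv N_neq1.
have u_in : `|(u + 9)%R|%N \in iota 0 19 by rewrite mem_iota; lia.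
have v_in : `|v|%N \in iota 1 9 by rewrite mem_iota; lia.
have := allP (allP check _ u_in) _ v_in; rewrite /ok.
have -> : `|(u + 9)%R|%N%:Z - 9 = u by lia.
have -> : `|v|%N%:Z = v by lia.
by rewrite co_uv (negPf N_neq1).
Qed.

Lemma exists_rescaled_direction (u v : int) : rescalable u v ->
  exists u' v', [/\ norm_form u' v' = 49 * norm_form u v, coprimez u' v',
    0 < v' <= 99 & `|u'| * (v' - 1) + 2 * v' <= 100 * (v' - 9)].
Proof.
by move=> /hasP[[u' v'] _ /and4P[/eqP ? ? ? ?]]; exists u', v'.
Qed.

(* The norm of [l + w] is [(x^2 + 3) / 4] for [l = (x + 1) / 2]. *)
Lemma exists_coprime_direction (p : nat) :
    prime p -> (p %% 3 = 2)%N -> (2 < p)%N ->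
  exists u v : int, [/\ nonsquare_direction p u v, coprimez u v, `|u| <= v
     & v ^+ 2 <= p%:Z].
Proof.
move=> p_pr p_mod p_gt2.
have [two_neq0 three_neq0] := natF_2_3_neq0 p_pr p_mod p_gt2.
have nsq3 := nonsquareN3 p_pr p_mod p_gt2.
have [x nsq] := exists_nonsquare_shift three_neq0 nsq3.
have [u0 [v0 [v0_gt0 u0_le v0_le eq_u0]]] :=
  exists_small_ratio ((x + 1) / 2%:R) p_pr.
have v0F : v0%:~R != 0 :> 'F_p.
  rewrite -dvdz_intF //; apply/negP => /dvdzP[k def_v0].
  have k_gt0 : 0 < k by nia.
  have v0_ge : p%:Z <= v0 by nia.
  nia.
have nsq0 : nonsquare_direction p u0 v0.
  apply: contra nsq => /=.
  have -> : (norm_form u0 v0)%:~R = (v0%:~R / 2%:R) ^+ 2 * (x ^+ 2 + 3%:R) :> 'F_p.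
    transitivity (u0%:~R ^+ 2 - u0%:~R * v0%:~R + v0%:~R ^+ 2 : 'F_p).
      by rewrite /norm_form; ring.
    by rewrite eq_u0; field; rewrite two_neq0.
  by apply: nonsquare_mul_exp2; rewrite mulf_neq0 ?invr_neq0.
(* Dividing by the gcd changes the norm only by the square [g^2]. *)
pose g := gcdz u0 v0.
have g_gt0 : 0 < g by rewrite ltz_nat gcdn_gt0 !absz_gt0 (gt_eqF v0_gt0) orbT.
have [u1 def_u] := dvdzP (dvdz_gcdl u0 v0).
have [v1 def_v] := dvdzP (dvdz_gcdr u0 v0).
rewrite -/g in def_u def_v.
have co1 : coprimez u1 v1.
  apply/eqP/(mulfI (lt0r_neq0 g_gt0)).
  by rewrite -{1}(gtz0_abs g_gt0) mulz_gcdr ![g * _]mulrC -def_u -def_v mul1r.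
have nsq1 : nonsquare_direction p u1 v1.
  apply: contra nsq0 => sq.
  have -> : norm_form u0 v0 = g ^+ 2 * norm_form u1 v1.
    by rewrite def_u def_v /norm_form; ring.
  by rewrite rmorphM rmorphXn /=; apply: is_squareM; first exact: is_square_exp2.
have v1_gt0 : 0 < v1 by rewrite -(pmulr_lgt0 _ g_gt0) -def_v.
have u1_le : u1 ^+ 2 <= p%:Z.
  apply: le_trans u0_le; rewrite def_u exprMn.
  by rewrite ler_peMr ?sqr_ge0 // expr_ge1 // ltW.
have v1_le : v1 ^+ 2 <= p%:Z.
  apply: le_trans v0_le; rewrite def_v exprMn.
  by rewrite ler_peMr ?sqr_ge0 // expr_ge1 // ltW.
(* The norm is invariant under swapping the coordinates and under changing both signs. *)
have [u1_v1|v1_u1] := leP `|u1| v1; first by exists u1, v1.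
have [u1_ge0|u1_lt0] := leP 0 u1.
  exists v1, u1; split=> //; [|by rewrite coprimez_sym|lia].
  have -> // : nonsquare_direction p v1 u1 = nonsquare_direction p u1 v1.
  rewrite /nonsquare_direction (_ : norm_form v1 u1 = norm_form u1 v1) //.
  by rewrite /norm_form; ring.
exists (- v1), (- u1); rewrite sqrrN coprimezN coprimeNz coprimez_sym.
split=> //; last lia.
rewrite /nonsquare_direction (_ : norm_form (- v1) (- u1) = norm_form u1 v1) //.
by rewrite /norm_form; ring.
Qed.

Lemma exists_wide_direction (p Q : nat) :
    prime p -> (p %% 3 = 2)%N -> (2 < p <= Q)%N -> (900 <= Q)%N ->
  exists u v : int, [/\ nonsquare_direction p u v, coprimez u v
     & wide_direction Q u v].
Proof.
move=> p_pr p_mod /andP[p_gt2 p_le] Q_ge.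
have [u [v [nsq co_uv u_le v_le]]] := exists_coprime_direction p_pr p_mod p_gt2.
have v_gt0 : 0 < v.
  rewrite lt_neqAle (le_trans (normr_ge0 u) u_le) andbT eq_sym.
  apply: contraNneq nsq => v0; move: u_le; rewrite v0 normr_le0 => /eqP ->.
  exact: is_square0.
have N_neq1 : norm_form u v != 1.
  apply: contraNneq nsq => ->; apply/existsP; exists 1; by rewrite expr1n.
have [v_ge10|v_lt10] := leP 10 v.
  exists u, v; split=> //; apply/and3P; split=> //; first nia.
  have u_lt : `|u| <= v - 1.
    have : `|u| != v.
      apply: contraTneq co_uv => eq_uv; rewrite coprimezE.
      by rewrite (_ : `|u|%N = `|v|%N) ?/coprime ?gcdnn; lia.
    lia.
  have : `|u| * (v - 1) <= (v - 1) * (v - 1) by apply: ler_wpM2r; lia.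
  (* For small [v] the bound 900 on [Q] is used: the worst case [v = 10], [|u| = 9] needs Q >= 890.
     For larger [v], [v^2 <= p <= Q] is enough. *)
  have [v_lt|v_ge] := ltP v 20.
    have : (v - 9) * 900 <= (v - 9) * Q%:Z by apply: ler_wpM2l; lia.
    have : (v - 10) * (v - 20) <= 0 by apply: mulr_ge0_le0; lia.
    lia.
  have : (v - 9) * v ^+ 2 <= (v - 9) * Q%:Z by apply: ler_wpM2l; lia.
  have : 0 <= (v - 20) * v ^+ 2 by apply: mulr_ge0; lia.
  lia.
have [|u' [v' [eq_N co' v'_b crit]]] := @exists_rescaled_direction u v.
  by apply: small_rescalable; lia.
exists u', v'; split=> //.
  apply: contra nsq => /=.
  rewrite eq_N rmorphM /= (_ : 49%:~R = 7%:R ^+ 2); last by ring.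
  apply: nonsquare_mul_exp2; rewrite natF_neq0 // dvdn_prime2 //; lia.
have : (v' - 9) * 900 <= (v' - 9) * Q%:Z by apply: ler_wpM2l; nia.
rewrite /wide_direction; nia.
Qed.

(* An entry [(Q, v, y)], with [Q] a power of the prime [p], certifies the
   direction [(1, v)]: as [y^2 = - 3 norm_form 1 v] modulo [p] and [- 3] is a
   nonsquare, so is [norm_form 1 v]. *)
Definition midrange_table : seq (nat * nat * nat) :=
  [:: (125, 12, 1); (131, 12, 16); (137, 13, 25); (149, 14, 14); (167, 11, 1);
  (173, 18, 64); (179, 11, 5); (191, 11, 7); (197, 18, 8); (227, 11, 11);
  (233, 22, 3); (239, 19, 40); (251, 11, 13); (257, 19, 16); (263, 27, 28);
  (269, 22, 15); (281, 22, 4); (289, 12, 3); (293, 19, 27); (311, 29, 7);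
  (317, 15, 1); (347, 32, 12); (353, 27, 3); (359, 14, 13); (383, 24, 16);
  (389, 27, 15); (401, 35, 6); (419, 14, 17); (431, 11, 23); (443, 15, 45);
  (449, 41, 4); (461, 18, 1); (467, 31, 3); (479, 36, 7); (491, 29, 4);
  (503, 37, 5); (509, 54, 8); (521, 18, 11); (529, 17, 3); (557, 27, 26);
  (563, 34, 3); (569, 52, 24); (587, 57, 20); (593, 36, 31); (599, 32, 4);
  (617, 48, 4); (625, 12, 1); (641, 57, 6); (647, 33, 8); (653, 27, 34);
  (659, 19, 17); (677, 34, 4); (683, 58, 18); (701, 54, 35); (719, 22, 7);
  (743, 45, 1); (761, 23, 1); (773, 23, 5); (797, 15, 31); (809, 45, 23);
  (821, 50, 6); (827, 19, 25); (839, 37, 14); (841, 23, 4); (857, 38, 8);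
  (863, 42, 3); (881, 50, 24); (887, 14, 35)].

(* The prime powers below 900 missing from [midrange_table]; collisions for
   [Q], [2 Q] and [3 Q] are listed in [collision_table]. *)
Definition exceptional : seq nat :=
  [:: 5; 11; 17; 23; 25; 29; 41; 47; 53; 59; 71; 83; 89; 101; 107; 113; 121].

Definition certified_direction (Q v y : nat) : bool :=
  [&& (pdiv Q %| y ^ 2 + 3 * (v ^ 2 - v + 1))%N,
      ~~ (pdiv Q %| v ^ 2 - v + 1)%N, (0 < v)%N & wide_direction Q 1 v%:Z].

Lemma midrange_table_certified :
  all (fun w => certified_direction w.1.1 w.1.2 w.2) midrange_table.
Proof. by vm_compute. Qed.

Lemma midrange_table_complete :
  all (fun Q => if primes Q is [:: p] then
      (2 < p)%N && (p %% 3 == 2)%N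
        ==> (Q \in exceptional ++ [seq w.1.1 | w <- midrange_table])
    else true) (iota 0 900).
Proof. by vm_compute. Qed.

Lemma midrange_direction (p s : nat) :
    prime p -> (p %% 3 = 2)%N -> (2 < p)%N -> (p ^ s.+1 < 900)%N ->
    (p ^ s.+1)%N \notin exceptional ->
  exists v : nat,
    nonsquare_direction p 1 v%:Z /\ wide_direction (p ^ s.+1) 1 v%:Z.
Proof.
move=> p_pr p_mod p_gt2.
have : primes (p ^ s.+1) = [:: p] by rewrite primesX // primes_prime.
have : pdiv (p ^ s.+1) = p by rewrite pdiv_pfactor.
move: (p ^ s.+1)%N => Q pdiv_Q primes_Q Q_lt Q_exc.
have Q_in : Q \in iota 0 900 by rewrite mem_iota add0n.
have := allP midrange_table_complete Q Q_in.
rewrite primes_Q p_gt2 p_mod eqxx mem_cat (negPf Q_exc) => /mapP[[[Q' v] y]].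
move=> /(allP midrange_table_certified) cert eq_Q; move: cert; rewrite -eq_Q.
rewrite /certified_direction pdiv_Q => /and4P[root ndiv v_gt0 wide].
exists v; split=> //.
rewrite /nonsquare_direction.
have -> : norm_form 1 v%:Z = (v ^ 2 - v + 1)%N%:Z.
  have v_le : (v <= v ^ 2)%N by rewrite -{1}(expn1 v) leq_pexp2l.
  by rewrite /norm_form PoszD -subzn //; ring.
apply/negP => /existsP[a /eqP a2].
have /negP[] := nonsquareN3 p_pr p_mod p_gt2.
have a_neq0 : a != 0.
  by rewrite -sqrf_eq0 a2 -[_%:~R]/(_%:R) natF_neq0.
apply/existsP; exists (y%:R / a); apply/eqP.
have : (y ^ 2 + 3 * (v ^ 2 - v + 1))%:R = 0 :> 'F_p.
  by apply/eqP; rewrite -(dvdn_pcharf (pchar_Fp p_pr)).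
rewrite natrD natrM natrX (_ : (v ^ 2 - v + 1)%:R = a ^+ 2) // => /eqP.
rewrite addr_eq0 => /eqP y2.
by rewrite expr_div_n y2 mulNr mulfK // expf_neq0.
Qed.

Lemma exists_direction (p s : nat) :
    prime p -> (p %% 3 = 2)%N -> (2 < p)%N -> (p ^ s.+1)%N \notin exceptional ->
  exists u v : int, [/\ nonsquare_direction p u v, coprimez u v
     & wide_direction (p ^ s.+1) u v].
Proof.
move=> p_pr p_mod p_gt2 not_exc.
have [Q_lt|Q_ge] := ltnP (p ^ s.+1) 900.
  have [v [nsq wide]] := midrange_direction p_pr p_mod p_gt2 Q_lt not_exc.
  by exists 1, v%:Z; split=> //; rewrite coprimezE coprime1n.
apply: exists_wide_direction => //.
by rewrite p_gt2 -{1}(expn1 p) leq_exp2l ?prime_gt1.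
Qed.

Local Close Scope ring_scope.

(** * Collisions *)

Definition has_collision (m : nat) : Prop :=
  exists a h : nat, [/\ 0 < a, 0 < h, a + h <= (9 ^ trunc_log 3 m).+1
    & m ^ 2 %| h * (3 * a ^ 2 + 3 * a * h + h ^ 2 + 1)].

(* Entries [(m, a, h)]. *)
Definition collision_table : seq (nat * nat * nat) :=
  [:: (4, 1, 4); (5, 3, 2); (7, 3, 5); (10, 3, 2); (11, 1, 14); (12, 1, 9);
  (14, 3, 7); (15, 7, 18); (17, 8, 11); (21, 8, 9); (22, 1, 14);
  (23, 13, 11); (25, 8, 12); (28, 10, 7); (29, 37, 20); (33, 5, 27);
  (34, 21, 13); (41, 15, 34); (46, 34, 7); (47, 16, 41); (50, 8, 12);
  (51, 26, 18); (53, 28, 74); (58, 37, 20); (59, 41, 14); (69, 29, 45);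
  (71, 72, 38); (75, 75, 18); (82, 15, 34); (83, 130, 11); (87, 7, 81);
  (89, 64, 17); (94, 13, 46); (101, 163, 42); (106, 75, 42); (107, 39, 89);
  (113, 71, 41); (118, 41, 14); (121, 126, 27); (123, 246, 9);
  (141, 118, 90); (142, 98, 35); (159, 139, 9); (166, 130, 11);
  (177, 152, 36); (178, 55, 34); (202, 163, 42); (213, 87, 81);
  (214, 159, 31); (226, 179, 11); (242, 126, 27); (249, 293, 63);
  (267, 272, 378); (303, 152, 63); (321, 289, 342); (339, 449, 423);
  (363, 126, 27)].

(** The divisibility is evaluated in binary [N], since the numbers are too large for unary
    arithmetic. *)
Lemma collision_table_certified :
  all (fun w => let m := N.of_nat w.1.1 in
      let a := N.of_nat w.1.2 in let h := N.of_nat w.2 in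
    [&& 0 < w.1.2, 0 < w.2, w.1.2 + w.2 <= (9 ^ trunc_log 3 w.1.1).+1
      & ((h * (3 * a * a + 3 * a * h + h * h + 1)) mod (m * m) =? 0)%num])
    collision_table.
Proof. by vm_compute. Qed.

Lemma table_collision (m : nat) :
  m \in [seq w.1.1 | w <- collision_table] -> has_collision m.
Proof.
move=> /mapP[[[k a] h] /(allP collision_table_certified) cert ->].
move: cert; rewrite [w in w.1.1]/=.
move=> /and4P[a_gt0 h_gt0 le_ah /N.eqb_spec dvd].
exists a, h; split=> //; apply/dvdnP.
have /N.Div0.mod_divides[q def_q] := dvd; exists (N.to_nat q).
by move: def_q; cbn [fst snd]; lia.
Qed.

(** With K the logarithm of [m], m < 3^(K+1) gives m^2 < 9^(K+1), so a bound of m^2 / 9 + 1 on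
    [a + h] suffices. *)
Lemma has_collision_intro (m d e a h : nat) :
    m ^ 2 = d * e -> 0 < m -> d %| h ->
    e %| 3 * a ^ 2 + 3 * a * h + h ^ 2 + 1 -> 0 < a -> 0 < h ->
    9 * (a + h) <= m ^ 2 + 9 ->
  has_collision m.
Proof.
move=> def_m2 m_gt0 dvd_h dvd_f a_gt0 h_gt0 bound.
exists a, h; split=> //; last by rewrite def_m2 dvdn_mul.
have m_lt : m < 3 ^ (trunc_log 3 m).+1 by rewrite trunc_log_ltn.
have : m ^ 2 < 9 * 9 ^ trunc_log 3 m.
  rewrite -expnS (_ : 9 = 3 ^ 2) // -expnM mulnC expnM.
  by rewrite ltn_exp2r.
lia.
Qed.

(** * Moduli divisible by a prime congruent to 1 modulo 3 *)

Lemma collision_1mod3 (p m : nat) :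
  prime p -> p %% 3 = 1 -> 13 <= p -> p %| m -> 0 < m -> has_collision m.
Proof.
move=> p_pr p_mod p_ge /dvdnP[k ->]; rewrite muln_gt0 => /andP[k_gt0 p_gt0].
have [x x_lt root_x] : exists2 x, x < p & p %| 3 * x ^ 2 + 1.
  have [x root_x] := exists_root_3x2_plus1 p_pr p_mod.
  exists x; first by rewrite -[X in _ < X](card_Fp p_pr) card_ord ltn_ord.
  rewrite (dvdn_pcharf (pchar_Fp p_pr)) natrD natrM natrX natr_Zp.
  by rewrite root_x.
have [a [a_gt0 a_le root_a]] :
    exists a, [/\ 0 < a, 2 * a <= p & p %| 3 * a ^ 2 + 1].
  have x_gt0 : 0 < x.
    by case: (posnP x) root_x => // ->; rewrite dvdn1 => /eqP; lia.
  have [x_le|x_gt] := leqP (2 * x) p; first by exists x.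
  have def_p : p = x + (p - x) by rewrite subnKC // ltnW.
  exists (p - x); split; [lia | lia |].
  move: (p - x) def_p => z def_p.
  have /dvdn_addl <- : p %| 3 * x * p by rewrite dvdn_mull.
  rewrite (_ : 3 * z ^ 2 + 1 + 3 * x * p = 3 * x ^ 2 + 1 + 3 * z * p).
    by rewrite dvdn_addl // dvdn_mull.
  by rewrite def_p; lia.
(* As [p] divides [h], the congruence modulo [e = p] reduces to [3 a^2 + 1 = 0]. *)
apply: (@has_collision_intro _ (p * k ^ 2) p a (p * k ^ 2)) => //.
- by rewrite expnMn; lia.
- by rewrite muln_gt0 k_gt0.
- have -> : 3 * a ^ 2 + 3 * a * (p * k ^ 2) + (p * k ^ 2) ^ 2 + 1
     = 3 * a ^ 2 + 1 + p * (3 * a * k ^ 2 + p * k ^ 4) by lia.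
  by rewrite dvdn_add // dvdn_mulr.
- by rewrite muln_gt0 p_gt0 expn_gt0 k_gt0.
(* The bound amounts to [9 a <= p (p - 9) k^2 + 9], with [p = 13 + q]; it is tightest at [p = 13],
   [a = 6], [k = 1]. *)
- move: p_ge k_gt0 a_le; clear => /subnKC; move: (p - 13) => q <- k_gt0 a_le.
  have : (13 + q) * (4 + q) * 1 <= (13 + q) * (4 + q) * k ^ 2.
    by rewrite leq_mul2l expn_gt0 k_gt0 orbT.
  lia.
Qed.

(* The entry of index [d] is a pair [(h, a)]. *)
Definition roots_mod49 : seq (nat * nat) :=
  [:: (1, 4); (2, 8); (1, 8); (3, 8); (3, 41); (1, 3); (2, 41); (1, 17);
  (2, 8); (1, 8); (3, 8); (3, 24); (1, 41); (2, 31); (1, 38); (2, 8); (1, 8);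
  (3, 8); (3, 3); (1, 38); (2, 17); (1, 10); (2, 8); (1, 8); (3, 8); (3, 31);
  (1, 31); (2, 3); (1, 31); (2, 8); (1, 8); (3, 8); (3, 10); (1, 24);
  (2, 38); (1, 3); (2, 8); (1, 4); (3, 8); (3, 38); (1, 17); (2, 24);
  (1, 24); (2, 4); (1, 8); (3, 4); (3, 17); (1, 10); (2, 10)].

Lemma exists_root_mod49 (d : nat) : exists h a, [/\ 0 < h <= 3, 0 < a <= 49
  & 49 %| 3 * a ^ 2 + 3 * a * (d * h) + (d * h) ^ 2 + 1].
Proof.
pose h r := (nth (0, 0) roots_mod49 r).1.
pose a r := (nth (0, 0) roots_mod49 r).2.
pose ok r := [&& 0 < h r <= 3, 0 < a r <= 49
  & 49 %| 3 * a r ^ 2 + 3 * a r * (r * h r) + (r * h r) ^ 2 + 1].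
have check : all ok (iota 0 49) by vm_compute.
have r_in : d %% 49 \in iota 0 49 by rewrite mem_iota add0n ltn_mod.
have /and3P[] := allP check _ r_in.
move: (h _) (a _) => {h a ok check} h a h_b a_b root; exists h, a; split=> //.
move: root; rewrite {3 4}(divn_eq d 49).
move: (d %/ 49) (d %% 49) => q r root.
have -> : 3 * a ^ 2 + 3 * a * ((q * 49 + r) * h) + ((q * 49 + r) * h) ^ 2 + 1
   = 3 * a ^ 2 + 3 * a * (r * h) + (r * h) ^ 2 + 1
     + 49 * (3 * a * q * h + (q * 49 + 2 * r) * q * h ^ 2) by lia.
exact: dvdn_add root (dvdn_mulr _ (dvdnn _)).
Qed.

(** A step [h] divisible by [7 k^2] would be too long, as 9 * 7 > 49, so all of 49 goes into [e].
    The bound [9 (49 + 3 k^2) <= 49 k^2 + 9] holds from [k = 5] on. *)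
Lemma collision_7 (m : nat) : 7 %| m -> 0 < m -> has_collision m.
Proof.
move=> /dvdnP[k ->]; rewrite muln_gt0 => /andP[k_gt0 _].
have [k_lt|k_ge] := ltnP k 5.
  by apply: table_collision; case: k k_gt0 k_lt => [|[|[|[|[]]]]].
have [h [a [/andP[h_gt0 h_le] /andP[a_gt0 a_le] root]]] :=
  exists_root_mod49 (k ^ 2).
apply: (@has_collision_intro _ (k ^ 2) 49 a (k ^ 2 * h)) => //.
- by rewrite expnMn.
- by rewrite muln_gt0 k_gt0.
- by rewrite dvdn_mulr.
- by rewrite muln_gt0 expn_gt0 k_gt0.
- rewrite expnMn.
  have : 25 <= k ^ 2 by rewrite (@leq_exp2r 5 k 2).
  have : k ^ 2 * h <= k ^ 2 * 3 by rewrite leq_mul2l h_le orbT.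
  lia.
Qed.

(** For [a = 1] the second factor is [h^2 + 3 h + 4], a multiple of 4 when h = 1 mod 4. The sum
    [9^j + 1] attains the permitted maximum, so [has_collision_intro] cannot be applied. *)
Lemma collision_2mul3exp (j : nat) : has_collision (2 * 3 ^ j).
Proof.
exists 1, (9 ^ j); split=> //; first by rewrite expn_gt0.
  rewrite add1n ltnS leq_exp2l //.
  by apply: trunc_log_max => //; rewrite leq_pmull.
have -> : (2 * 3 ^ j) ^ 2 = 9 ^ j * 4.
  by rewrite expnMn -[9]/(3 ^ 2) -!expnM mulnC [j * 2]mulnC.
rewrite dvdn_mul //.
have [q ->] : exists q, 9 ^ j = 4 * q + 1.
  elim: j => [|j [q IHj]]; first by exists 0.
  by exists (9 * q + 2); rewrite expnS IHj; lia.
by apply/dvdnP; exists (4 * q ^ 2 + 5 * q + 2); lia.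
Qed.

(** * Moduli divisible by 4 *)

Lemma exists_root_mod16 (t : nat) : odd t ->
  exists2 a, 0 < a <= 6 & 16 %| 3 * a ^ 2 + 3 * a * t ^ 2 + (t ^ 2) ^ 2 + 1.
Proof.
move=> odd_t.
have [j ->] : exists j, t ^ 2 = 8 * j + 1.
  have [q [->|->]] : exists q, t = 4 * q + 1 \/ t = 4 * q + 3.
    by exists (t %/ 4); lia.
  - by exists (2 * q ^ 2 + q); lia.
  - by exists (2 * q ^ 2 + 3 * q + 1); lia.
(* [t^2] is 1 or 9 modulo 16, with roots [a = 6] and [a = 1] respectively. *)
have [i [->|->]] : exists i, j = 2 * i \/ j = 2 * i + 1.
  by exists j./2; lia.
- by exists 6 => //; apply/dvdnP; exists (16 * i ^ 2 + 20 * i + 8); lia.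
- by exists 1 => //; apply/dvdnP; exists (16 * i ^ 2 + 21 * i + 7); lia.
Qed.

Lemma collision_4_mul_odd (t : nat) : odd t -> has_collision (t * 4).
Proof.
move=> odd_t.
have [t_lt|t_ge] := ltnP t 5.
  by apply: table_collision; case: t odd_t t_lt => [|[|[|[|[]]]]].
have [a /andP[a_gt0 a_le] root] := exists_root_mod16 odd_t.
apply: (@has_collision_intro _ (t ^ 2) 16 a (t ^ 2)) => //.
- by rewrite expnMn.
- by rewrite muln_gt0; lia.
- by rewrite expn_gt0; lia.
- rewrite expnMn; have : 25 <= t ^ 2 by rewrite (@leq_exp2r 5 t 2).
  lia.
Qed.

(* For [a = 2 c + 1] and [h = 4 t^2], the second factor of the difference is 4
   times the quadratic polynomial below. *)
Lemma collision_8_of_root (r t c : nat) : let M := 2 ^ (r.+1 * 2) in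
    M %| 3 * c ^ 2 + (3 + 6 * t ^ 2) * c + (1 + 3 * t ^ 2 + 4 * (t ^ 2) ^ 2) ->
    0 < t -> 9 * (2 * c + 1 + 4 * t ^ 2) <= 16 * (M * t ^ 2) + 9 ->
  has_collision (t * 2 ^ r.+3).
Proof.
move=> M root t_gt0 bound.
have def_m2 : (t * 2 ^ r.+3) ^ 2 = 4 * t ^ 2 * (4 * M).
  by rewrite expnMn -expnM -[r.+3 * 2]/(4 + r.+1 * 2) expnD; lia.
apply: (@has_collision_intro _ (4 * t ^ 2) (4 * M) (2 * c + 1)
  (4 * t ^ 2)) => //.
- by rewrite muln_gt0 t_gt0 expn_gt0.
- rewrite [X in _ %| X](_ : _ = 4 * (3 * c ^ 2 + (3 + 6 * t ^ 2) * c
    + (1 + 3 * t ^ 2 + 4 * (t ^ 2) ^ 2))); last lia.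
  by rewrite dvdn_pmul2l.
- by rewrite addn1.
- by rewrite muln_gt0 expn_gt0 t_gt0.
- by rewrite def_m2; move: bound; lia.
Qed.

Lemma collision_4 (m : nat) : 4 %| m -> 0 < m -> has_collision m.
Proof.
move=> dvd4 m_gt0.
have [t co_t ->] := pfactor_coprime (isT : prime 2) m_gt0.
have odd_t : odd t by rewrite -coprime2n.
have : 2 <= logn 2 m by rewrite -pfactor_dvdn.
case: (logn 2 m) => [|[|[|r]]] // _; first exact: collision_4_mul_odd.
have t_gt0 : 0 < t by rewrite odd_gt0.
pose M := 2 ^ (r.+1 * 2).
have M_ge : 4 <= M by rewrite /M mulSn expnD leq_pmulr // expn_gt0.
have [c c_lt root] : exists2 c, c < M
    & M %| 3 * c ^ 2 + (3 + 6 * t ^ 2) * c + (1 + 3 * t ^ 2 + 4 * (t ^ 2) ^ 2).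
  apply: (@quadratic_hensel_nat 2 _ _ _ 0%R) => //.
    rewrite coprimezE coprime2n; move: (t ^ 2) => T.
    rewrite (_ : (_ - _)%R = - (12 * (T ^ 2)%N%:Z + 3)%R)%R; last by lia.
    by rewrite abszN; lia.
  have : odd (t ^ 2) by rewrite oddX odd_t.
  by move: (t ^ 2) => T; lia.
(* For [t >= 3] the bound [c < M] is enough; for [t = 1] the smaller of two roots must be chosen. *)
have [t1|t_neq1] := eqVneq t 1; last first.
  have T_ge : 9 <= t ^ 2.
    rewrite (@leq_exp2r 3 t 2) //.
    by case: t odd_t t_gt0 t_neq1 {co_t root} => [|[|[]]].
  apply: (collision_8_of_root root) => //; rewrite -/M.
  move: (t ^ 2) T_ge M_ge c_lt => T T_ge M_ge c_lt.
  have : 9 * M <= T * M by rewrite leq_mul2r T_ge orbT.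
  have : 4 * T <= M * T by rewrite leq_mul2r M_ge orbT.
  move: M c_lt {root M_ge}; lia.
have {}root : M %| 3 * c ^ 2 + 9 * c + 8 by move: root; rewrite t1.
(* The other root is [M - 3 - c]. *)
have [c' c'_le root'] : exists2 c', 2 * c' + 3 <= M
    & M %| 3 * c' ^ 2 + 9 * c' + 8.
  have [c_le|c_gt] := leqP (2 * c + 3) M; first by exists c.
  (* At [c = M - 1] and [c = M - 2] the polynomial is 2 modulo [M], so neither is a root and
     [M - 3 - c] is not negative. *)
  have c_le3 : c + 3 <= M.
    have not_dvd2 : ~~ (M %| 2) by rewrite gtnNdvd //; lia.
    have [//|[eq_c|eq_c]] : c + 3 <= M \/ c + 1 = M \/ c + 2 = M by lia.
    - case/negP: not_dvd2.
      have /dvdn_addr <- : M %| 3 * c.+2 * M by rewrite dvdn_mull.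
      by rewrite (_ : _ + 2 = 3 * c ^ 2 + 9 * c + 8) // -eq_c; lia.
    - case/negP: not_dvd2.
      have /dvdn_addr <- : M %| 3 * c.+1 * M by rewrite dvdn_mull.
      by rewrite (_ : _ + 2 = 3 * c ^ 2 + 9 * c + 8) // -eq_c; lia.
  have [z def_M] : exists z, M = c + z + 3 by exists (M - 3 - c); lia.
  exists z; first lia.
  have /dvdn_addl <- : M %| 3 * c * M by rewrite dvdn_mull.
  rewrite (_ : _ + _ = 3 * c ^ 2 + 9 * c + 8 + 3 * z * M); last by rewrite def_M; lia.
  by rewrite dvdn_add // dvdn_mull.
rewrite t1; apply: (@collision_8_of_root r 1 c') => //.
by rewrite -/M; lia.
Qed.

(** * Moduli divisible by an odd prime congruent to 2 modulo 3 *)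

Lemma large_cofactor_bound (p t h a P : nat) :
    prime p -> p %% 3 = 2 -> 2 < p -> ~~ (p %| t) -> 4 < t ->
    2 * h <= p -> a <= P -> p ^ 2 <= P ->
  9 * (a + t ^ 2 * h) <= P * t ^ 2 + 9.
Proof.
move=> p_pr p_mod p_gt2 p_t t_ge5 h_le a_le P_ge.
(* For [p = 5], integrality gives [h <= 2], and [t] prime to 5 gives [t >= 6]; the next prime is
   11. *)
have [p5|p_neq5] := eqVneq p 5.
  have t_neq5 : t != 5 by apply: contraNneq p_t => ->; rewrite p5.
  have T_ge : 36 <= t ^ 2 by rewrite (@leq_exp2r 6 t 2) // ltn_neqAle eq_sym t_neq5.
  have h_le2 : t ^ 2 * h <= t ^ 2 * 2 by rewrite leq_mul2l; apply/orP; right; lia.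
  move: P_ge; rewrite p5 => P_ge.
  have : (36 - 9) * (25 - 18) <= (t ^ 2 - 9) * (P - 18) by apply: leq_mul; lia.
  nia.
have p_ge : 11 <= p.
  have p_neq8 : p != 8 by apply: contraTneq p_pr => ->.
  lia.
have T_ge : 25 <= t ^ 2 by rewrite (@leq_exp2r 5 t 2).
move: (t ^ 2) T_ge => T T_ge.
have h_le2 : T * (2 * h) <= T * p by rewrite leq_mul2l h_le orbT.
have : (2 * T - 18) * p ^ 2 <= (2 * T - 18) * P by rewrite leq_mul2l P_ge orbT.
have : (2 * T - 18) * 11 * p <= (2 * T - 18) * p * p.
  by rewrite leq_mul2r leq_mul2l p_ge !orbT.
move: h_le2; have [T' ->] : exists T', T = 25 + T' by exists (T - 25); lia.
have -> : 2 * (25 + T') - 18 = 32 + 2 * T' by lia.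
lia.
Qed.

(** With [H = t^2 h], the discriminant in [a] is [-3 (H^2 + 4)]. Taking H = x or -x modulo [p] with
    [x^2 + 4] a nonsquare makes it a nonzero square, and the choice of sign gives [2 h <= p]. *)
Lemma collision_large_cofactor (p s t : nat) :
    prime p -> p %% 3 = 2 -> 2 < p -> ~~ (p %| t) -> 4 < t ->
  has_collision (p ^ s.+1 * t).
Proof.
move=> p_pr p_mod p_gt2 p_t t_ge5.
have p_gt0 := prime_gt0 p_pr.
have t_gt0 : 0 < t by apply: leq_trans t_ge5.
have [two_neq0 three_neq0] := natF_2_3_neq0 p_pr p_mod p_gt2.
have t_neq0 : (t%:R != 0 :> 'F_p)%R by rewrite natF_neq0.
have four_neq0 : (4%:R != 0 :> 'F_p)%R.
  by rewrite (natrM _ 2 2) mulf_neq0.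
have nsq3 := nonsquareN3 p_pr p_mod p_gt2.
have [x nsq] := exists_nonsquare_shift four_neq0 nsq3.
have /existsP[y /eqP y2] : is_square (- 3%:R * (x ^+ 2 + 4%:R))%R.
  exact: nonsquareM.
have x_neq0 : x != 0%R.
  apply: contraNneq nsq => ->; apply/existsP; exists 2%:R%R.
  by apply/eqP; ring.
have [h [h_gt0 h_le hF]] : exists h : nat, [/\ 0 < h, 2 * h <= p
    & ((t ^ 2 * h)%:R ^+ 2 = x ^+ 2 :> 'F_p)%R].
  pose z : 'F_p := (x / t%:R ^+ 2)%R.
  have z_lt : z < p by rewrite -[X in _ < X](card_Fp p_pr) card_ord ltn_ord.
  have z_gt0 : 0 < z.
    rewrite lt0n; apply: contra x_neq0 => /eqP z0.
    have /eqP : z = 0%R by apply: val_inj.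
    by rewrite mulf_eq0 invr_eq0 expf_eq0 (negPf t_neq0) orbF.
  have tz : ((t ^ 2)%:R * z = x)%R by rewrite natrX mulrC divfK // expf_neq0.
  have [z_le|z_gt] := leqP (2 * z) p.
    by exists z; split=> //; rewrite natrM natr_Zp tz.
  exists (p - z); split; first by rewrite subn_gt0.
    by rewrite mulnBr leq_subCl mul2n -addnn addnK ltnW.
  by rewrite natrM natrB 1?ltnW // pchar_Fp_0 // sub0r natr_Zp mulrN tz sqrrN.
pose H := t ^ 2 * h.
have [a0 def_a0] := exists_int_lift ((y - 3%:R * H%:R) / (2%:R * 3%:R))%R.
have disc : coprimez p ((3 * H)%N%:Z ^+ 2 - 4 * 3 * (H ^ 2 + 1)%N%:Z)%R.
  rewrite coprimez_intF //.
  rewrite PoszM PoszD -mulnn PoszM.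
  have -> : (((3 * H%:Z) ^+ 2 - 4 * 3 * (H%:Z * H%:Z + 1))%:~R
     = - 3%:R * (H%:R ^+ 2 + 4%:R) :> 'F_p)%R by ring.
  rewrite hF mulf_neq0 ?oppr_eq0 //.
  by apply: contraNneq nsq => ->; exact: is_square0.
have root0 : (p %| (3 * a0 ^+ 2 + (3 * H)%N%:Z * a0 + (H ^ 2 + 1)%N%:Z)%R)%Z.
  rewrite dvdz_intF // PoszM PoszD -mulnn PoszM.
  have -> : ((3 * a0 ^+ 2 + 3 * H%:Z * a0 + (H%:Z * H%:Z + 1))%:~R
     = 3%:R * a0%:~R ^+ 2 + 3%:R * H%:R * a0%:~R + H%:R ^+ 2 + 1 :> 'F_p)%R by ring.
  rewrite def_a0.
  have -> : (3%:R * ((y - 3%:R * H%:R) / (2%:R * 3%:R)) ^+ 2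
     + 3%:R * H%:R * ((y - 3%:R * H%:R) / (2%:R * 3%:R)) + H%:R ^+ 2 + 1
     = (y ^+ 2 + 3%:R * (H%:R ^+ 2 + 4%:R)) / (2%:R * 2%:R * 3%:R) :> 'F_p)%R.
    by field; rewrite (natrM _ 4 3) (natrM _ 2 3) !mulf_neq0.
  by apply/eqP; rewrite y2 hF; ring.
have [a1 a1_lt root1] := quadratic_hensel_nat (s.+1 * 2) p_gt0 disc root0.
pose Q := p ^ s.+1.
rewrite expnM -/Q in a1_lt root1.
have Q_gt0 : 0 < Q by rewrite expn_gt0 p_gt0.
have root1' : Q ^ 2 %| 3 * a1 ^ 2 + 3 * a1 * H + H ^ 2 + 1.
  by rewrite -addnA mulnAC.
(* The root 0 is replaced by [Q^2], as [a] must be positive. *)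
have [a [a_gt0 a_le root]] : exists a, [/\ 0 < a, a <= Q ^ 2
    & Q ^ 2 %| 3 * a ^ 2 + 3 * a * H + H ^ 2 + 1].
  case: (posnP a1) root1' => [->|a1_gt0] root1'; last first.
    by exists a1; split=> //; exact: ltnW.
  exists (Q ^ 2); rewrite leqnn expn_gt0 Q_gt0; split=> //.
  move: root1'; rewrite !muln0 !mul0n !add0n => root1'.
  rewrite -addnA dvdn_add // dvdn_add //; first by rewrite dvdn_mull // dvdn_mulr.
  by rewrite mulnAC dvdn_mull.
apply: (@has_collision_intro _ (t ^ 2) (Q ^ 2) a H) => //.
- by rewrite mulnC expnMn.
- by rewrite muln_gt0 Q_gt0.
- by rewrite dvdn_mulr.
- by rewrite muln_gt0 h_gt0 expn_gt0 t_gt0.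
rewrite expnMn -/Q /H; apply: (@large_cofactor_bound p) => //.
by rewrite leq_exp2r // -{1}(expn1 p) leq_exp2l ?prime_gt1.
Qed.

Lemma collision_small_cofactor (p s t : nat) :
    prime p -> p %% 3 = 2 -> 2 < p -> 0 < t < 4 -> ~~ (p %| t) ->
  has_collision (p ^ s.+1 * t).
Proof.
move=> p_pr p_mod p_gt2 t_b p_t.
have p_gt0 := prime_gt0 p_pr.
have [exc|not_exc] := boolP (p ^ s.+1 \in exceptional).
  apply: table_collision.
  have check : all (fun Q => all (fun t =>
    Q * t \in [seq w.1.1 | w <- collision_table]) [:: 1; 2; 3]) exceptional by vm_compute.
  by apply: (allP (allP check _ exc)); rewrite !inE; lia.
have [u [v [nsq co_uv wide]]] := exists_direction p_pr p_mod p_gt2 not_exc.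
have p_t2 : ~~ (p %| t ^ 2) by rewrite Euclid_dvdX // andbT.
have [x [y [/andP[x_gt0 xy] y_le sol]]] :=
  exists_small_solution p_pr p_mod p_gt2 p_t2 co_uv nsq wide.
have t_gt0 : 0 < t by lia.
apply: (@has_collision_intro _ (t ^ 2) ((p ^ s.+1) ^ 2) (t ^ 2 * x)
  (t ^ 2 * (y - x))) => //.
- by rewrite mulnC expnMn.
- by rewrite muln_gt0 t_gt0 expn_gt0 p_gt0.
- by rewrite dvdn_mulr.
(* With b = a + h, [3 a^2 + 3 a h + h^2 = a^2 + a b + b^2]; the factor [t^4] comes from using [t^2]
   as the parameter of [exists_small_solution]. *)
- move: sol; rewrite -{1 2}(subnKC (ltnW xy)); move: (y - x) => d.
  by congr (_ %| _); lia.
- by rewrite muln_gt0 x_gt0 expn_gt0 t_gt0.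
- by rewrite muln_gt0 subn_gt0 xy expn_gt0 t_gt0.
rewrite expnMn -mulnDr subnKC 1?ltnW // mulnCA.
have : t ^ 2 * (9 * y) <= t ^ 2 * (p ^ s.+1) ^ 2 by rewrite leq_mul2l y_le orbT.
lia.
Qed.

(** * The discriminator *)

Lemma collision_2mod3 (p m : nat) :
    prime p -> p %% 3 = 2 -> 2 < p -> p %| m -> ~~ (4 %| m) -> 0 < m ->
  has_collision m.
Proof.
move=> p_pr p_mod p_gt2 p_m not4 m_gt0.
have [t co_t def_m] := pfactor_coprime p_pr m_gt0.
have p_t : ~~ (p %| t) by rewrite -prime_coprime.
have : 0 < logn p m by rewrite logn_gt0 mem_primes p_pr m_gt0.
case def_s: (logn p m) => [|s] // _; rewrite def_s mulnC in def_m.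
have t_gt0 : 0 < t by move: m_gt0; rewrite def_m muln_gt0 => /andP[].
have [t_le4|t_gt4] := leqP t 4; rewrite def_m; last exact: collision_large_cofactor.
apply: collision_small_cofactor => //; rewrite t_gt0 ltn_neqAle t_le4 andbT.
by apply: contraNneq not4 => t4; rewrite def_m t4 dvdn_mull.
Qed.

(** Every divisor [u > 1] of the part [t] of [m] prime to 3 is even, so [t] is 1, 2 or a multiple of
    4, and only 2 survives the hypotheses. *)
Lemma collision_of_primes_le3 (m : nat) :
    0 < m -> ~~ (4 %| m) -> (forall p, prime p -> p %| m -> p <= 3) ->
    (forall i, m != 3 ^ i) -> has_collision m.
Proof.
move=> m_gt0 not4 primes_m not3.
have [t co_t def_m] := pfactor_coprime (isT : prime 3) m_gt0.
have t_gt0 : 0 < t by move: m_gt0; rewrite def_m muln_gt0 => /andP[].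
have pdiv2 u : 1 < u -> u %| t -> 2 %| u.
  move=> u_gt1 u_t; have p_pr := pdiv_prime u_gt1.
  have p_t := dvdn_trans (pdiv_dvd u) u_t.
  have : pdiv u <= 3 by apply: primes_m => //; rewrite def_m dvdn_mulr.
  rewrite leq_eqVlt => /orP[/eqP p3|].
    by move: co_t; rewrite prime_coprime // -p3 p_t.
  rewrite ltnS leq_eqVlt ltnNge prime_gt1 // orbF => /eqP <-; exact: pdiv_dvd.
have t_neq1 : t != 1.
  by apply: contraNneq (not3 (logn 3 m)) => t1; rewrite {1}def_m t1 mul1n.
have /dvdnP[u def_t] : 2 %| t by apply: pdiv2 => //; rewrite ltn_neqAle eq_sym t_neq1.
have [u1|u_neq1] := eqVneq u 1.
  by rewrite def_m def_t u1 mul1n; apply: collision_2mul3exp.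
case/negP: not4; rewrite def_m dvdn_mulr // def_t (_ : 4 = 2 * 2) // dvdn_mul //.
apply: pdiv2; last by rewrite def_t dvdn_mulr.
by rewrite ltn_neqAle eq_sym u_neq1; move: t_gt0; rewrite def_t muln_gt0 => /andP[].
Qed.

Lemma collision_3exp (i : nat) : has_collision (3 ^ i).
Proof.
exists 1, (9 ^ i); split=> //; first by rewrite expn_gt0.
  by rewrite trunc_expnK // add1n.
by rewrite -expnM mulnC expnM dvdn_mulr.
Qed.

Lemma all_have_collision (m : nat) : 0 < m -> has_collision m.
Proof.
move=> m_gt0.
have [dvd4|not4] := boolP (4 %| m); first exact: collision_4.
have [dvd7|not7] := boolP (7 %| m); first exact: collision_7.
have [big|small] := boolP (has (fun p => 3 < p) (primes m)).
  have /hasP[p] := big; rewrite mem_primes => /and3P[p_pr _ p_m] p_gt3.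
  have [p1|p_mod1] := eqVneq (p %% 3) 1.
    apply: (collision_1mod3 p_pr) => //.
    have p_neq7 : p != 7 by apply: contraNneq not7 => <-.
    have p_neq4 : p != 4 by apply: contraTneq p_pr => ->.
    have p_neq10 : p != 10 by apply: contraTneq p_pr => ->.
    lia.
  apply: (collision_2mod3 p_pr) => //; last exact: ltnW.
  have : ~~ (3 %| p) by rewrite dvdn_prime2 //; lia.
  lia.
have small_primes p : prime p -> p %| m -> p <= 3.
  move=> p_pr p_m; rewrite leqNgt; apply: contra small => p_gt3.
  by apply/hasP; exists p; rewrite // mem_primes p_pr m_gt0.
have [/eqP->|neq] := boolP (m == 3 ^ logn 3 m); first exact: collision_3exp.
apply: collision_of_primes_le3 => // i.
by apply: contraNneq neq => ->; rewrite pfactorK.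
Qed.

Lemma cube_plus_self_sub (a h : nat) :
  (a + h) ^ 3 + (a + h)
    = a ^ 3 + a + h * (3 * a ^ 2 + 3 * a * h + h ^ 2 + 1).
Proof. lia. Qed.

Lemma distinct_mod_sqP (n m : nat) :
  reflect (forall a h, 0 < a -> 0 < h -> a + h <= n ->
      ~~ (m ^ 2 %| h * (3 * a ^ 2 + 3 * a * h + h ^ 2 + 1)))
    (distinct_mod_sq n m).
Proof.
have neqE a h : (a ^ 3 + a != (a + h) ^ 3 + (a + h) %[mod m ^ 2])
    = ~~ (m ^ 2 %| h * (3 * a ^ 2 + 3 * a * h + h ^ 2 + 1)).
  by rewrite eq_sym cube_plus_self_sub eqn_mod_dvd ?leq_addr // addKn.
rewrite /distinct_mod_sq pairwise_map.
apply: (iffP (pairwiseP 0)) => [dist a h a_gt0 h_gt0 le_n | dist i j].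
  have := dist a.-1 (a + h).-1; rewrite !inE size_iota.
  have a_lt : a.-1 < n by lia.
  have b_lt : (a + h).-1 < n by lia.
  rewrite !nth_iota // !add1n !prednK ?addn_gt0 ?a_gt0 // -neqE.
  by apply=> //; lia.
rewrite !inE size_iota => i_lt j_lt ij.
rewrite !nth_iota // (_ : 1 + j = 1 + i + (j - i)); last by lia.
by rewrite /= neqE; apply: dist; lia.
Qed.

Lemma collision_not_distinct (n m : nat) :
  has_collision m -> 9 ^ trunc_log 3 m < n -> ~~ distinct_mod_sq n m.
Proof.
move=> [a [h [a_gt0 h_gt0 le_ah dvd]]] lt_n.
apply/distinct_mod_sqP => /(_ a h a_gt0 h_gt0 (leq_trans le_ah lt_n)).
by rewrite dvd.
Qed.

Lemma distinct_mod_9exp (n k : nat) : n <= 9 ^ k -> distinct_mod_sq n (3 ^ k).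
Proof.
move=> n_le; apply/distinct_mod_sqP => a h a_gt0 h_gt0 le_n.
have def_9k : (3 ^ k) ^ 2 = 9 ^ k by rewrite -expnM mulnC expnM.
have co3 : coprime 3 (3 * a ^ 2 + 3 * a * h + h ^ 2 + 1).
  rewrite prime_coprime //.
  have [q [|[|]] ->] : exists q, h = 3 * q \/ h = 3 * q + 1 \/ h = 3 * q + 2.
  - by exists (h %/ 3); lia.
  - lia.
  - lia.
  - lia.
rewrite Gauss_dvdl; last by rewrite !coprimeXl.
by rewrite def_9k gtnNdvd //; lia.
Qed.

Lemma sqrt_le_3exp (R : realType) (n k : nat) :
  (Num.sqrt n%:R <= 3 ^+ k :> R)%R = (n <= 9 ^ k).
Proof.
rewrite -[leRHS]ger0_norm ?exprn_ge0 // -sqrtr_sqr ler_sqrt ?sqr_ge0 //.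
by rewrite -!natrX ler_nat -expnM mulnC expnM.
Qed.

Theorem theorem1p1 (R : realType) (n : nat) (hn : 2 <= n) :
  D n = 3 ^ min_exponent R n.
Proof.
rewrite /min_exponent; case: ex_minnP => k /andP[k_gt0].
rewrite sqrt_le_3exp => n_le k_min.
rewrite /D; case: ex_minnP => m /andP[m_gt0 dist] m_min.
apply/eqP; rewrite eqn_leq m_min ?expn_gt0 ?distinct_mod_9exp // leqNgt.
apply: contraL dist => m_lt.
apply: collision_not_distinct; first exact: all_have_collision.
set i := trunc_log 3 m.
have i_lt : i < k.
  by rewrite -(@ltn_exp2l 3) //; apply: leq_ltn_trans m_lt; apply: trunc_logP.
(* [k] is minimal among positive exponents only; for [i = 0] the required [9^0 < n] is the
   assumption [2 <= n]. *)
case def_i: i => [|i']; first exact: hn.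
rewrite ltnNge -def_i; apply/negP => n_le_i.
have : k <= i by apply: k_min; rewrite sqrt_le_3exp n_le_i def_i.
by rewrite leqNgt i_lt.
Qed.
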